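(* Let $R$ be a locally essential integral domain with quotient field $K$, and let $\mathrm{Int}(R) := \{f \in K[X] : f(R) \subseteq R\}$ be the ring of integer-valued polynomials over $R$. Then $\dim(\mathrm{Int}(R)) = \dim(R[X])$, where $\dim$ denotes Krull dimension.
   Context: An integral domain $R$ is called essential if it is an intersection of valuation rings that are localizations of $R$, i.e., there is a set $\Delta \subseteq \mathrm{Spec}(R)$ of prime ideals such that $R_p$ is a valuation domain for each $p \in \Delta$ and $R = \bigcap_{p \in \Delta} R_p$ (intersection inside the quotient field of $R$; a field counts as a trivial valuation domain). An integral domain $R$ is called locally essential if the localization $R_p$ is essential for every $p \in \mathrm{Spec}(R)$. Here $X$ is an indeterminate over $K$, and the Krull dimension takes values in $\mathbb{N} \cup \{\infty\}$. *)

(* Defs.v *)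
From HB Require Import structures.
From mathcomp Require Import all_boot all_algebra.
From mathcomp Require Import boolp classical_sets.

Set Implicit Arguments.
Unset Strict Implicit.
Unset Printing Implicit Defensive.

Import GRing.Theory.
Local Open Scope classical_set_scope.
Local Open Scope ring_scope.

Notation tofrac := (@FracField.tofrac _) (only parsing).
Notation "x %:F" := (@FracField.tofrac _ x) : ring_scope.

(* Prime ideals are the library's [prime_idealr], which are boolean predicates;
   classically, [asbool] turns any prime ideal into one. *)

Section Localization.
Variables (R : idomainType) (p : prime_idealr R).

Definition loc_pred : {pred {fraction R}} :=
  [pred x | `[< exists a b : R, b \notin p /\ x = a%:F / b%:F >]].

Lemma loc_predP x :
  reflect (exists a b : R, b \notin p /\ x = a%:F / b%:F) (x \in loc_pred).
Proof. exact: asboolP. Qed.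

Lemma prime_notin_neq0 (b : R) : b \notin p -> b%:F != 0.
Proof. by rewrite tofrac_eq0; apply: contraNneq => ->; rewrite idealr0. Qed.

Lemma loc_subring_closed : subring_closed loc_pred.
Proof.
split=> [|x y /loc_predP[a [b [pb ->]]] /loc_predP[c [d [pd ->]]]
         |x y /loc_predP[a [b [pb ->]]] /loc_predP[c [d [pd ->]]]].
- by apply/loc_predP; exists 1, 1; rewrite idealr1 tofrac1 divr1.
- have b0 := prime_notin_neq0 pb; have d0 := prime_notin_neq0 pd.
  apply/loc_predP; exists (a * d - c * b), (b * d).
  rewrite prime_idealrM negb_or pb pd; split=> //.
  by rewrite tofracB !tofracM -mulNr addf_div // mulNr.
- apply/loc_predP; exists (a * c), (b * d).
  by rewrite prime_idealrM negb_or pb pd !tofracM mulf_div.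
Qed.

HB.instance Definition _ :=
  GRing.isSubringClosed.Build {fraction R} loc_pred loc_subring_closed.

(* The localization R_p, as a subring of the quotient field of R. *)
Record localization := Localization {
  loc_val :> {fraction R};
  _ : loc_val \in loc_pred
}.

HB.instance Definition _ := [isSub for loc_val].
HB.instance Definition _ := [Choice of localization by <:].
HB.instance Definition _ :=
  [SubChoice_isSubComNzRing of localization by <:].

Definition loc_unit : {pred localization} :=
  [pred x | (val x != 0) && ((val x)^-1 \in loc_pred)].
Definition loc_inv (x : localization) : localization := insubd x (val x)^-1.

Lemma val_loc_inv (x : localization) :
  val (loc_inv x) = if (val x)^-1 \in loc_pred then (val x)^-1 else val x.
Proof. by rewrite /loc_inv val_insubd. Qed.

Lemma loc_mulVx : {in loc_unit, left_inverse 1 loc_inv *%R}.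
Proof.
move=> x /andP[x0 xV]; apply: val_inj.
by rewrite rmorphM rmorph1 /= val_loc_inv xV mulVf.
Qed.

Lemma loc_unitPl (x y : localization) : y * x = 1 -> loc_unit x.
Proof.
move=> /(congr1 val); rewrite rmorphM rmorph1 /= => yx1.
have x0 : val x != 0.
  by apply: contra_eq_neq yx1 => /= ->; rewrite mulr0 eq_sym oner_neq0.
apply/andP; split=> //.
by rewrite -[_^-1]mul1r -yx1 mulfK //; exact: valP.
Qed.

Lemma loc_inv_out : {in [predC loc_unit], loc_inv =1 id}.
Proof.
move=> x; rewrite inE /= negb_and negbK => /orP[/eqP x0|xV].
  by apply: val_inj; rewrite val_loc_inv x0 invr0; case: ifP.
by apply: val_inj; rewrite val_loc_inv (negPf xV).
Qed.

HB.instance Definition _ := GRing.ComNzRing_hasMulInverse.Build localization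
  loc_mulVx loc_unitPl loc_inv_out.

Lemma loc_integral : GRing.integral_domain_axiom localization.
Proof.
move=> x y /(congr1 val)/eqP; rewrite rmorphM /=.
by rewrite -!(inj_eq val_inj) rmorph0 -mulf_eq0.
Qed.

HB.instance Definition _ :=
  GRing.ComUnitRing_isIntegral.Build localization loc_integral.

End Localization.

(* Fields are valuation domains for this definition. *)
Definition valuation_domain (V : idomainType) : Prop :=
  forall x : {fraction V}, x != 0 -> range tofrac x \/ range tofrac x^-1.

Definition essential (R : idomainType) : Prop :=
  exists D : set (prime_idealr R),
    (forall p, D p -> valuation_domain (localization p)) /\
    range (tofrac : R -> {fraction R}) =
      \bigcap_(p in D) [set x | x \in loc_pred p].

Definition locally_essential (R : idomainType) : Prop :=
  forall p : prime_idealr R, essential (localization p).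

Section IntegerValued.
Variable R : idomainType.

Definition int_pred : {pred {poly {fraction R}}} :=
  [pred f | `[< forall a : R, range (tofrac : R -> {fraction R}) f.[a%:F] >]].

Lemma int_predP f :
  reflect (forall a : R, range (tofrac : R -> {fraction R}) f.[a%:F])
          (f \in int_pred).
Proof. exact: asboolP. Qed.

Lemma int_subring_closed : subring_closed int_pred.
Proof.
split=> [|f g /int_predP fR /int_predP gR|f g /int_predP fR /int_predP gR];
  apply/int_predP => a.
- by exists 1 => //; rewrite hornerC tofrac1.
- have [b _ fb] := fR a; have [c _ gc] := gR a.
  by exists (b - c) => //; rewrite tofracB hornerD hornerN fb gc.
- have [b _ fb] := fR a; have [c _ gc] := gR a.
  by exists (b * c) => //; rewrite tofracM hornerM fb gc.
Qed.

HB.instance Definition _ :=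
  GRing.isSubringClosed.Build {poly {fraction R}} int_pred int_subring_closed.

(* The ring Int(R), as a subring of K[X]. *)
Record int_poly := IntPoly {
  int_poly_val :> {poly {fraction R}};
  _ : int_poly_val \in int_pred
}.

HB.instance Definition _ := [isSub for int_poly_val].
HB.instance Definition _ := [Choice of int_poly by <:].
HB.instance Definition _ := [SubChoice_isSubComNzRing of int_poly by <:].

End IntegerValued.

Definition prime_chain (A : comNzRingType) (n : nat) : Prop :=
  exists c : 'I_n.+1 -> prime_idealr A,
    forall i j : 'I_n.+1, (i < j)%N ->
      [set x | x \in c i] `<` [set x | x \in c j].

(* The supremum of the lengths of chains of primes, computed in
   nat extended with infinity: [None] stands for infinity. *)
Definition krull_dim (A : comNzRingType) : option nat :=
  match pselect (exists m,
    `[< forall n, prime_chain A n -> (n <= m)%N >]) with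
  | left bounded => Some (ex_minn bounded)
  | right _ => None
  end.

Lemma krull_dim_SomeP (A : comNzRingType) (d : nat) :
  krull_dim A = Some d <->
  (forall n, prime_chain A n -> (n <= d)%N) /\
  (forall m, (forall n, prime_chain A n -> (n <= m)%N) -> (d <= m)%N).
Proof.
rewrite /krull_dim; case: pselect => [bnd|unb].
  case: ex_minnP => e /asboolP eub emin; split=> [[<-]|[dub dmin]].
    by split=> // m mub; apply: emin; apply/asboolP.
  congr Some; apply/eqP; rewrite eqn_leq dmin // andbT.
  by apply: emin; apply/asboolP.
by split=> // -[dub _]; case: unb; exists d; apply/asboolP.
Qed.

Lemma krull_dim_NoneP (A : comNzRingType) :
  krull_dim A = None <-> forall m, exists2 n, prime_chain A n & (m < n)%N.
Proof.
rewrite /krull_dim; case: pselect => [bnd|unb]; split=> //.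
  move=> /(_ (ex_minn bnd))[n]; case: ex_minnP => e /asboolP eub _ /eub.
  by rewrite leqNgt => /negP.
move=> _ m; apply: contrapT => nex; apply: unb; exists m; apply/asboolP => n cn.
by rewrite leqNgt; apply/negP => mn; apply: nex; exists n.
Qed.

(* Main.v *)
(* It suffices to compare, for each n, the prime chains of length n in Int(R) and in
   R[X].  Let m be the contraction to R of the top of a chain.

   If R_m is a valuation domain, then in any ring A with R <= A <= K[X] at most one
   step of the chain preserves the contraction to R, because any two elements of A
   are algebraically dependent over R.  So a chain of length n + 1 in A contracts to
   a chain of length n in R, which lifts to a chain of length n + 1 in both Int(R)
   and R[X], namely 0 followed by the primes { f | f(0) \in p }.

   Otherwise R_m is an intersection of localizations R_p at primes p strictly
   contained in m.  For such p the ring R/p is infinite, so interpolation gives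
   Int(R) <= R_p[X].  Hence Int(R) <= R_m[X], and Int(R) and R[X] have the same
   localization at R \ m, so that chains below m can be transferred. *)

From HB Require Import structures.
Require Import Defs.
From mathcomp Require Import all_boot all_algebra.
From mathcomp Require Import boolp classical_sets.

Set Implicit Arguments.
Unset Strict Implicit.
Unset Printing Implicit Defensive.

Import GRing.Theory.
Local Open Scope ring_scope.

(** * Prime ideals and chains *)

Lemma exists_prime_idealr (A : comNzRingType) (P : A -> Prop) :
  P 0 -> ~ P 1 -> (forall x y, P x -> P y -> P (x - y)) ->
  (forall a x, P x -> P (a * x)) ->
  (forall x y, P (x * y) -> P x \/ P y) ->
  exists q : prime_idealr A, forall x, (x \in q) = `[< P x >].
Proof.
move=> P0 P1 PB PM Pp; pose S : A -> bool := fun x => `[< P x >].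
have SP x : reflect (P x) (x \in S) by apply: asboolP.
have S_ideal : idealr_closed S.
  split; [exact/SP | by apply/negP => /SP |].
  move=> a x y /SP Px /SP Py; apply/SP.
  have -> : a * x + y = a * x - (0 - y) by rewrite sub0r opprK.
  exact/PB/PB/Py/P0/PM.
have S_prime : prime_idealr_closed S.
  by move=> x y /SP/Pp[] /SP ->; rewrite ?orbT.
pose q : prime_idealr A := HB.pack S (isIdealr.Build A S S_ideal)
  (isPrimeIdealrClosed.Build A S S_prime).
by exists q.
Qed.

Section Contraction.
Variables (A B : comNzRingType) (f : {rmorphism A -> B}) (q : prime_idealr B).

Lemma contraction_exists : exists p : prime_idealr A, forall x, (x \in p) = (f x \in q).
Proof.
have [||x y xq yq|a x xq|x y|p pE] := @exists_prime_idealr A (fun x => f x \in q).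
- by rewrite rmorph0 idealr0.
- by rewrite rmorph1 idealr1.
- by rewrite rmorphB rpredB.
- by rewrite rmorphM idealMr.
- by rewrite rmorphM prime_idealrM => /orP.
by exists p => x; rewrite pE asboolb.
Qed.

Definition contraction := projT1 (cid contraction_exists).

Lemma contractionE x : (x \in contraction) = (f x \in q).
Proof. exact: (projT2 (cid contraction_exists)). Qed.

End Contraction.

Lemma zero_prime (A : idomainType) :
  exists q : prime_idealr A, forall x, (x \in q) = (x == 0).
Proof.
have [||x y -> ->|a x ->|x y /eqP|p pE] := @exists_prime_idealr A (fun x => x = 0).
- by [].
- exact/eqP/oner_neq0.
- by rewrite subr0.
- by rewrite mulr0.
- by rewrite mulf_eq0 => /orP[] /eqP; [left | right].
by exists p => x; rewrite pE; apply/asboolP/eqP.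
Qed.

Section Chains.
Variable A : comNzRingType.
Implicit Types p q : prime_idealr A.

Definition lt_prime p q := {subset p <= q} /\ exists2 x, x \in q & x \notin p.

Lemma lt_prime_trans p q r : lt_prime p q -> lt_prime q r -> lt_prime p r.
Proof.
by move=> [pq [x xq xp]] [qr _]; split; [move=> y /pq /qr | exists x; rewrite ?qr].
Qed.

(** Indexing by [nat] makes it easy to shift and skip indices; values beyond [n] are
    unconstrained. *)
Lemma prime_chainP n :
  prime_chain A n <->
  exists c : nat -> prime_idealr A,
    forall i k, (i < k <= n)%N -> lt_prime (c i) (c k).
Proof.
split=> [[c cP]|[c cP]].
  exists (fun i => c (inord i)) => i k /andP[ik kn].
  have := cP (inord i) (inord k).
  rewrite !inordK ?ltnS ?(leq_trans (ltnW ik)) // => /(_ ik) [sub nsub].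
  split=> //; apply: contrapT => nex; apply: nsub => x /= xk.
  by apply/negPn/negP => xi; apply: nex; exists x.
exists (fun i => c i) => i k ik.
have [|sub [x xk /negP xi]] := cP i k; first by rewrite ik -ltnS ltn_ord.
by split=> // /(_ x xk).
Qed.

Lemma chain_of_steps n (c : nat -> prime_idealr A) :
  (forall i, (i < n)%N -> lt_prime (c i) (c i.+1)) -> prime_chain A n.
Proof.
move=> cS; apply/prime_chainP; exists c => i k /andP[].
elim: k => // k IHk; rewrite ltnS leq_eqVlt => /predU1P[<-|ik] kn; first exact: cS.
by apply: lt_prime_trans (cS _ kn); apply: IHk => //; apply: ltnW.
Qed.

End Chains.

(** * Dividing a family by an entry of least valuation *)

Section Scaling.
Variables (R : idomainType) (m : prime_idealr R).

(* Divisibility in [R_m] is total, i.e. [R_m] is a valuation domain. *)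
Definition valuation_at :=
  forall a b : R, exists2 s, s \notin m &
    exists d, s * a = d * b \/ s * b = d * a.

Hypothesis m_val : valuation_at.

(** [e] is an entry of least valuation in R_m, and [s] clears the denominators of the quotients by
    [e]. In the induction the new entry is compared with the minimum of the tail. *)
Lemma exists_minimal_valuation (l : seq R) a :
  exists2 e, e \in a :: l & exists2 s, s \notin m &
    forall x, x \in a :: l -> exists d, s * x = e * d.
Proof.
elim: l a => [|b l IHl] a.
  exists a; rewrite ?mem_head //; exists 1; rewrite ?idealr1 //.
  by move=> x; rewrite inE => /eqP ->; exists 1; rewrite mulrC.
have [e el [s sm sP]] := IHl b.
have [t tm [d [ae|ea]]] := m_val a e.
  exists e; first by rewrite inE el orbT.
  exists (t * s); first by rewrite prime_idealrM negb_or tm sm.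
  move=> x; rewrite inE => /predU1P[->|/sP[d' xE]].
    by exists (s * d); rewrite -mulrA mulrCA ae mulrA mulrC.
  by exists (t * d'); rewrite -mulrA xE mulrCA.
exists a; first exact: mem_head.
exists (t * s); first by rewrite prime_idealrM negb_or tm sm.
move=> x; rewrite inE => /predU1P[->|/sP[d' xE]]; first by exists (t * s); rewrite mulrC.
by exists (d * d'); rewrite -mulrA xE [t * _]mulrA ea mulrAC mulrC.
Qed.

(** As with dividing a polynomial by its content, a nonzero family becomes a proportional one with a
    coefficient outside [m]: the entry equal to [e] turns into [s]. *)
Lemma scale_family (I : eqType) (l : seq I) (c : I -> R) i0 :
  i0 \in l -> c i0 != 0 ->
  exists e s d, [/\ e != 0, s \notin m,
    {in l, forall i, s * c i = e * d i} & exists2 i, i \in l & d i \notin m].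
Proof.
move=> il ci0; have [e el [s sm sP]] := exists_minimal_valuation (map c l) (c i0).
have /choice[d dP] : forall i, exists d, i \in l -> s * c i = e * d.
  move=> i.
  have [ill|_] := boolP (i \in l); last by exists 0.
  by have [|d dE] := sP (c i); [rewrite inE map_f ?orbT | exists d].
have [k kl ek] : exists2 k, k \in l & e = c k.
  by move: el; rewrite inE => /predU1P[->|/mapP[k kl ->]]; [exists i0 | exists k].
have e0 : e != 0.
  apply: contraNneq ci0 => e0; have := dP _ il; rewrite e0 mul0r => /eqP.
  by rewrite mulf_eq0 => /predU1P[s0|//]; rewrite s0 idealr0 in sm.
exists e, s, d; split=> //; exists k => //.
by have := dP _ kl; rewrite -ek mulrC => /(mulfI e0) <-.
Qed.

End Scaling.

(** * Chains over a valuation domain *)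

Section HornerIdeal.
Variable A : comNzRingType.
Implicit Types (Q : prime_idealr A) (h : {poly A}).

Lemma horner_in_ideal Q h x : (forall k, h`_k \in Q) -> h.[x] \in Q.
Proof.
by move=> hQ; rewrite horner_coef rpred_sum // => i _; rewrite mulrC idealMr.
Qed.

Lemma lowest_coef_in_ideal Q Q' h x :
    {subset Q <= Q'} -> x \in Q' -> x \notin Q -> h.[x] \in Q ->
    (exists k, h`_k \notin Q) ->
  exists2 k, h`_k \notin Q & h`_k \in Q'.
Proof.
move=> QQ' xQ' xQ; elim/poly_ind: h => [|h c IHh].
  by move=> _ [k]; rewrite coef0 idealr0.
rewrite hornerMXaddC => hcQ [k hckQ].
have coefS i : (h * 'X + c%:P)`_i.+1 = h`_i by rewrite coefD coefMX coefC addr0.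
have coefZ : (h * 'X + c%:P)`_0 = c by rewrite coefD coefMX coefC add0r.
have [cQ|cQ] := boolP (c \in Q); last first.
  exists 0%N; rewrite coefZ //.
  by rewrite -[c](addKr (h.[x] * x)) addrC; apply: rpredB; [apply: QQ' | apply: idealMr].
have hQ : h.[x] \in Q.
  have : h.[x] * x \in Q by rewrite -[_ * _](addrK c) rpredB.
  by rewrite prime_idealrM (negPf xQ) orbF.
have [|i hiQ hiQ'] := IHh hQ; last by exists i.+1; rewrite coefS.
by case: k hckQ => [|k]; rewrite ?coefZ ?cQ // coefS => hkQ; exists k.
Qed.

End HornerIdeal.

Section ValuationBound.
Variables (R : idomainType) (A : comNzRingType) (iota : {rmorphism R -> A}).
Variable m : prime_idealr R.
Hypothesis m_val : valuation_at m.
Hypothesis iota_reg : forall e z, e != 0 -> iota e * z = 0 -> z = 0.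
Hypothesis dependent : forall x y : A, exists N (c : nat -> nat -> R),
  (exists i k, [/\ (i < N)%N, (k < N)%N & c i k != 0]) /\
  \sum_(i < N) \sum_(k < N) iota (c i k) * x ^+ i * y ^+ k = 0.
Implicit Types Q : prime_idealr A.

(** The class of [y] in A/Q is algebraic over the image of R. *)
Definition algebraic_mod Q y :=
  exists2 g : {poly R}, exists k, iota g`_k \notin Q & (map_poly iota g).[y] \in Q.

Definition below Q := forall a, iota a \in Q -> a \in m.
(** Used for [Q] contained in [Q'], where it amounts to equal contractions to R. *)
Definition same_contraction Q Q' := forall a, iota a \in Q' -> iota a \in Q.

Lemma horner_map_poly (n : nat) (d : nat -> R) y :
  (map_poly iota (\poly_(i < n) d i)).[y] = \sum_(i < n) iota (d i) * y ^+ i.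
Proof.
rewrite (@horner_coef_wide _ n); last by rewrite (leq_trans (size_poly _ _)) ?size_poly.
by apply: eq_bigr => i _; rewrite coef_map coef_poly ltn_ord.
Qed.

(** A relation modulo [Q] may vanish modulo [Q']. Scaling leaves a coefficient outside [m], hence
    outside [Q'], and the factor [e] cancels because its image is not in [Q]. *)
Lemma algebraic_mod_sub Q Q' y :
  {subset Q <= Q'} -> below Q' -> algebraic_mod Q y -> algebraic_mod Q' y.
Proof.
move=> QQ' Q'm [g [k gk] gy].
have gk0 : g`_k != 0 by apply: contraNneq gk => ->; rewrite rmorph0 idealr0.
have kn : k \in seq.iota 0 (size g).
  by rewrite mem_iota add0n; apply: contraR gk0 => kg; rewrite nth_default // leqNgt.
have [e [s [d [e0 sm dP [i il dim]]]]] :=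
  @scale_family _ _ m_val _ (seq.iota 0 (size g)) (fun i => g`_i) k kn gk0.
exists (\poly_(i < size g) d i).
  have {}il : (i < size g)%N by rewrite mem_iota in il.
  by exists i; rewrite coef_poly il; apply: contra dim => /Q'm.
apply: (QQ'); have sQ : iota s \notin Q by apply: contra sm => /QQ'/Q'm.
have eQ : iota e \notin Q.
  apply: contra sQ => eQ; have : iota (s * g`_k) \in Q.
    by rewrite dP // rmorphM mulrC idealMr.
  by rewrite rmorphM prime_idealrM (negPf gk) orbF.
have : iota e * (map_poly iota (\poly_(i < size g) d i)).[y] \in Q.
  suff -> : iota e * (map_poly iota (\poly_(i < size g) d i)).[y] =
            iota s * (map_poly iota g).[y] by rewrite idealMr.
  rewrite -{2}(coefK g) !horner_map_poly !big_distrr /=; apply: eq_bigr => j _.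
  by rewrite !mulrA -!rmorphM dP // mem_iota add0n ltn_ord.
by rewrite prime_idealrM (negPf eQ).
Qed.

(** The lowest coefficient outside [Q] of a relation for [y] would lie in [Q']; being a constant, it
    would then lie in [Q]. *)
Lemma not_algebraic_mod Q Q' y :
  {subset Q <= Q'} -> same_contraction Q Q' -> y \in Q' -> y \notin Q ->
  ~ algebraic_mod Q y.
Proof.
move=> QQ' same yQ' yQ [g [k gk] gy].
have [|i] := lowest_coef_in_ideal QQ' yQ' yQ gy; first by exists k; rewrite coef_map.
by rewrite coef_map => /negP giQ /same.
Qed.

(* In a dependence relation between x and y, ordered by powers of x, the lowest
   coefficient outside Q is a polynomial in y that lies in Q'. *)
Lemma algebraic_mod_above Q Q' x y :
    {subset Q <= Q'} -> same_contraction Q Q' -> below Q' ->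
    x \in Q' -> x \notin Q ->
  algebraic_mod Q' y.
Proof.
move=> QQ' same Q'm xQ' xQ; have [N [c [[i0 [k0 [i0N k0N c0]]] cxy]]] := dependent x y.
pose l := [seq (i, k) | i <- seq.iota 0 N, k <- seq.iota 0 N].
have lP i k : ((i, k) \in l) = (i < N)%N && (k < N)%N.
  apply/allpairsP/andP => [[[u v] /= []]|[iN kN]].
    by rewrite !mem_iota => uN vN [-> ->].
  by exists (i, k); rewrite !mem_iota.
have [||e [s [d [e0 sm dP [[i k]]]]]] :=
  @scale_family _ _ m_val _ l (fun ik => c ik.1 ik.2) (i0, k0).
- by rewrite lP i0N.
- by [].
rewrite lP => /andP[iN kN] dikm.
pose g i := \poly_(k < N) d (i, k).
pose h := \poly_(i < N) (map_poly iota (g i)).[y].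
have hx0 : h.[x] = 0.
  apply: (iota_reg e0); transitivity (iota s * 0); last by rewrite mulr0.
  rewrite -cxy horner_poly !big_distrr /=; apply: eq_bigr => u _.
  rewrite horner_map_poly mulrA big_distrr big_distrl big_distrr /=.
  apply: eq_bigr => v _; rewrite !mulrA -!rmorphM mulrAC.
  by rewrite (dP (val u, val v)) // lP !ltn_ord.
(* If all of [h] vanishes modulo [Q], then [g i], which has a coefficient outside [m], already gives
   a relation for [y]. *)
have [hQ|] := pselect (forall k, h`_k \in Q).
  apply: (algebraic_mod_sub QQ' Q'm); exists (g i).
    exists k; rewrite coef_poly kN.
    by apply: contra dikm => /QQ'/Q'm.
  by have := hQ i; rewrite coef_poly iN.
move=> nhQ; have [||j hjQ hjQ'] := lowest_coef_in_ideal QQ' xQ' xQ (h := h).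
- by rewrite hx0 idealr0.
- apply: contrapT => nex; apply: nhQ => j.
  by apply/negPn/negP => hj; apply: nex; exists j.
move: hjQ hjQ'; rewrite coef_poly; case: ifP => [jN gjQ gjQ'|_]; last first.
  by rewrite idealr0.
(* [g j] is nonzero modulo [Q']: otherwise all its coefficients would lie in [Q], and so would its
   value at [y]. *)
exists (g j) => //; apply: contrapT => nex; move/negP: gjQ; apply.
apply: horner_in_ideal => u; rewrite coef_map /=; apply: same.
by apply/negPn/negP => guQ; apply: nex; exists u.
Qed.

(** The first repeat makes [y] algebraic modulo [Q1], hence modulo [Q2]; the second makes it
    transcendental modulo [Q2]. *)
Lemma no_two_repeats Q0 Q1 Q2 Q3 :
    lt_prime Q0 Q1 -> {subset Q1 <= Q2} -> lt_prime Q2 Q3 -> below Q3 ->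
  same_contraction Q0 Q1 -> same_contraction Q2 Q3 -> False.
Proof.
move=> [Q01 [x xQ1 xQ0]] Q12 [Q23 [y yQ3 yQ2]] Q3m same01 same23.
have Q2m : below Q2 by move=> a /Q23/Q3m.
have Q1m : below Q1 by move=> a /Q12/Q2m.
apply: (not_algebraic_mod Q23 same23 yQ3 yQ2).
exact/(algebraic_mod_sub Q12 Q2m)/(algebraic_mod_above _ Q01 same01 Q1m xQ1 xQ0).
Qed.

Lemma contracted_chain n (c : nat -> prime_idealr A) :
    (forall i k, (i < k <= n.+1)%N -> lt_prime (c i) (c k)) -> below (c n.+1) ->
  prime_chain R n.
Proof.
move=> c_lt c_below.
have c_sub i k : (i <= k <= n.+1)%N -> {subset c i <= c k}.
  case/andP; rewrite leq_eqVlt => /predU1P[-> _ x //|ik kn].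
  by have [|] := c_lt i k; first by rewrite ik.
have no2 i k u v : (i < k)%N -> (k <= u)%N -> (u < v)%N -> (v <= n.+1)%N ->
    same_contraction (c i) (c k) -> same_contraction (c u) (c v) -> False.
  move=> ik ku uv vn; apply: no_two_repeats.
  - by apply: c_lt; rewrite ik (leq_trans ku) // (leq_trans (ltnW uv)).
  - by apply: c_sub; rewrite ku (leq_trans (ltnW uv)).
  - by apply: c_lt; rewrite uv.
  - by move=> a av; apply/c_below/(c_sub v) => //; rewrite vn leqnn.
have same_sub i k u v : (i <= k)%N -> (k <= u)%N -> (u <= v)%N -> (v <= n.+1)%N ->
    same_contraction (c i) (c v) -> same_contraction (c k) (c u).
  move=> ik ku uv vn same a au; apply: (c_sub i).
    by rewrite ik (leq_trans ku) ?(leq_trans uv).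
  by apply/same/(c_sub u) => //; rewrite uv.
(* [r] is the index to drop: the upper end of the repeated step, or the last index if no step
   repeats. [bump r] then enumerates the other indices. *)
have [r [rn rP]] : exists r, (r <= n.+1)%N /\
    forall u v, (u < v)%N -> (v <= n.+1)%N -> u != r -> v != r ->
      ~ same_contraction (c u) (c v).
  have [[i [i_n same_i]]|nosame] :=
      pselect (exists i, (i <= n)%N /\ same_contraction (c i) (c i.+1)).
    exists i.+1; split=> // u v uv vn ur vr same_uv.
    have [iu|ui] := ltnP i u.
      by apply: (no2 i i.+1 u v).
    have [vi|iv] := leqP v i; first by apply: (no2 u v i i.+1).
    have {}iv : (i.+1 < v)%N by rewrite ltn_neqAle eq_sym vr.
    apply: (no2 i i.+1 i.+1 v) => //.
    by apply: same_sub same_uv => //; [apply: leqW | apply: ltnW].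
  exists n.+1; split=> // u v uv vn un _ same_uv; apply: nosame; exists u; split.
    by rewrite -ltnS (leq_trans uv).
  exact: same_sub same_uv.
apply/prime_chainP; exists (fun i => contraction iota (c (bump r i))) => i k /andP[ik kn].
have bik : (bump r i < bump r k)%N by rewrite ltnNge leq_bump2 -ltnNge.
have bkn : (bump r k <= n.+1)%N by rewrite /bump -(add1n n) leq_add ?leq_b1.
split=> [a|]; first by rewrite !contractionE; apply: c_sub; rewrite (ltnW bik).
apply: contrapT => nex; apply: (rP _ _ bik bkn); rewrite 1?eq_sym ?neq_bump // => a ak.
by apply/negPn/negP => ai; apply: nex; exists a; rewrite contractionE.
Qed.

End ValuationBound.

(** * Dependence and interpolation *)

(** A dimension count: there are (d+2)^2 monomials, of size at most d(d+1)+1, so the matrix of their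
    coefficients has more rows than columns. *)
Lemma monomials_dependent (F : fieldType) (f g : {poly F}) :
  exists N (c : nat -> nat -> F),
    (exists i k, [/\ (i < N)%N, (k < N)%N & c i k != 0]) /\
    \sum_(i < N) \sum_(k < N) (c i k)%:P * f ^+ i * g ^+ k = 0.
Proof.
pose d := (size f + size g)%N; pose N := d.+2; pose w := (d.+1 * d).+1.
pose I := ('I_N * 'I_N)%type.
have size_exp (h : {poly F}) n : (size (h ^+ n)%R <= (n * size h).+1)%N.
  rewrite (leq_trans (size_poly_exp_leq _ _)) // ltnS mulnC leq_mul2l leq_pred.
  by rewrite orbT.
have size_fg (e : I) : (size (f ^+ e.1 * g ^+ e.2)%R <= w)%N.
  have /leq_trans -> // :
      (size (f ^+ e.1 * g ^+ e.2)%R <= (e.1 * size f + e.2 * size g).+1)%N.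
    rewrite (leq_trans (size_polyMleq _ _)) // -subn1 leq_subLR add1n.
    by rewrite -addSn -addnS leq_add ?size_exp.
  by rewrite ltnS /d mulnDr leq_add // leq_mul2r -ltnS ltn_ord orbT.
pose M : 'M[F]_(#|{: I}|, w) :=
  \matrix_(r < #|{: I}|) poly_rV (f ^+ (enum_val r).1 * g ^+ (enum_val r).2).
have kerM : kermx M != 0.
  rewrite -mxrank_eq0 mxrank_ker subn_eq0 -ltnNge.
  rewrite (leq_ltn_trans (rank_leq_col _)) // card_prod !card_ord /w /N.
  by rewrite [ltnRHS]mulSn mulnS addnA -add2n leq_add // leq_mul2l leqnSn orbT.
pose v := nz_row (kermx M).
have vM : v *m M = 0 by apply/sub_kermxP; exact: nz_row_sub.
have /rV0Pn[r vr] : v != 0 by rewrite nz_row_eq0.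
pose c i k := v 0 (enum_rank ((inord i, inord k) : I)).
exists N, c; split.
  exists (enum_val r).1, (enum_val r).2; split; rewrite ?ltn_ord //.
  by rewrite /c !inord_val -surjective_pairing enum_valK.
have := congr1 rVpoly vM; rewrite mulmx_sum_row linear_sum linear0; apply: etrans.
rewrite pair_bigA (reindex (@enum_val I predT)) /=; last exact/onW_bij/enum_val_bij.
apply: eq_bigr => s _; rewrite linearZ rowK /= poly_rV_K //.
by rewrite /c !inord_val -surjective_pairing enum_valK -mulrA mul_polyC.
Qed.

Lemma fraction_repr (R : idomainType) (x : {fraction R}) :
  exists2 a : R * R, a.2 != 0 & x = a.1%:F / a.2%:F.
Proof.
elim/quotW: x => y; exists (frac y); first exact: denom_ratioP.
apply: (canRL (mulfK _)); first by rewrite tofrac_eq0 denom_ratioP.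
unlock FracField.tofrac.
rewrite -[LHS]FracField.pi_mul; apply/eqmodP => /=.
rewrite /FracField.equivf /FracField.mulf.
rewrite !numden_Ratio ?mulf_neq0 ?denom_ratioP ?oner_neq0 //.
by rewrite !mulr1 mulrC.
Qed.

Lemma common_denominator (R : idomainType) (p : prime_idealr R) (I : eqType)
    (l : seq I) (x : I -> {fraction R}) :
    {in l, forall i, x i \in loc_pred p} ->
  exists s (a : I -> R), s \notin p /\ {in l, forall i, s%:F * x i = (a i)%:F}.
Proof.
elim: l => [|k l IHl] xp; first by exists 1, (fun=> 0); rewrite idealr1.
have [|s [a [sp aP]]] := IHl; first by move=> i il; rewrite xp // inE il orbT.
have /loc_predP[u [t [tp xE]]] := xp k (mem_head _ _).
exists (s * t), (fun i => if i == k then s * u else t * a i).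
split=> [|i]; first by rewrite prime_idealrM negb_or sp tp.
rewrite inE; case: eqP => [-> _|_ /= il]; rewrite !tofracM.
  by rewrite xE -mulrA; congr (_ * _); rewrite mulrC divfK // (prime_notin_neq0 tp).
by rewrite -aP // -mulrA mulrCA.
Qed.

(* Newton interpolation; the differences of the nodes are units of the subring. *)
Lemma polyOver_interpolation (F : fieldType) (S : subringClosed F) (f : {poly F})
    (a : nat -> F) :
    (forall i, a i \in S) -> (forall i, f.[a i] \in S) ->
    (forall i k, (i < k)%N -> a i != a k /\ (a i - a k)^-1 \in S) ->
  f \is a polyOver S.
Proof.
have [n] := ubnP (size f); elim: n => // n IHn in f a *.
rewrite ltnS => fn aS faS aV.
have /factor_theorem[q fE] : root (f - f.[a 0%N]%:P) (a 0%N).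
  by rewrite rootE hornerD hornerN hornerC subrr.
rewrite -[f](subrK f.[a 0%N]%:P) fE rpredD ?polyOverC ?rpredM ?polyOverXsubC //.
have [->|q0] := eqVneq q 0; first exact: rpred0.
apply: (IHn q (fun i => a i.+1)) => // [|i|i k ik]; last exact: aV.
  apply: leq_trans fn; have := size_polyD f (- f.[a 0%N]%:P).
  rewrite fE size_Mmonic ?monicXsubC // size_XsubC addn2 /= size_polyN leq_max.
  move=> /orP[//|/leq_trans/(_ (size_polyC_leq1 _))].
  by rewrite ltnS leqn0 size_poly_eq0 (negPf q0).
have [a0i a0iV] := aV 0%N i.+1 isT.
have a0i0 : a 0%N - a i.+1 != 0 by rewrite subr_eq0.
have -> : q.[a i.+1] = (f.[a 0%N] - f.[a i.+1]) * (a 0%N - a i.+1)^-1.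
  apply: (canRL (mulfK a0i0)); rewrite -opprB mulrN; apply/eqP.
  rewrite eqr_oppLR opprB; apply/eqP.
  have /(congr1 (horner^~ (a i.+1))) := fE.
  by rewrite hornerM hornerXsubC hornerD hornerN hornerC.
by rewrite rpredM // rpredB.
Qed.

(** * Localizations *)

Section ToLocalization.
Variables (R : idomainType) (p : prime_idealr R).

Lemma tofrac_in_loc (a : R) : a%:F \in loc_pred p.
Proof. by apply/loc_predP; exists a, 1; rewrite idealr1 tofrac1 divr1. Qed.

Definition to_loc (a : R) : localization p := Localization (tofrac_in_loc a).

Lemma to_loc_zmod_morphism : zmod_morphism to_loc.
Proof. by move=> a b; apply: val_inj; rewrite rmorphB /= tofracB. Qed.

Lemma to_loc_monoid_morphism : monoid_morphism to_loc.
Proof.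
split=> [|a b]; apply: val_inj; first by rewrite rmorph1 /= tofrac1.
by rewrite rmorphM /= tofracM.
Qed.

HB.instance Definition _ :=
  GRing.isZmodMorphism.Build R (localization p) to_loc to_loc_zmod_morphism.
HB.instance Definition _ :=
  GRing.isMonoidMorphism.Build R (localization p) to_loc to_loc_monoid_morphism.

Lemma to_loc_inj : injective to_loc.
Proof. by move=> a b /(congr1 val) /= /eqP; rewrite tofrac_eq => /eqP. Qed.

Lemma localization_repr (u : localization p) :
  exists2 s, s \notin p & exists a, u * to_loc s = to_loc a.
Proof.
have /loc_predP[a [s [sp uE]]] := valP u.
exists s => //; exists a; apply: val_inj.
by rewrite rmorphM /= in uE *; rewrite uE divfK // (prime_notin_neq0 sp).
Qed.

Lemma to_loc_notin (q : prime_idealr (localization p)) s :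
  s \notin p -> to_loc s \notin q.
Proof.
move=> sp; have sV : 1%:F / s%:F \in loc_pred p by apply/loc_predP; exists 1, s.
have sV1 : to_loc s * Localization sV = 1.
  apply: val_inj; rewrite rmorphM [RHS]rmorph1 -[LHS]/(s%:F * (1%:F / s%:F)).
  by rewrite mulrCA divff ?(prime_notin_neq0 sp) // mulr1 tofrac1.
 apply/negP => sq; have := idealr1 q.
by rewrite -sV1 prime_idealrM sq.
Qed.

End ToLocalization.

Lemma valuation_domain_total (V : idomainType) (a b : V) :
  valuation_domain V -> exists d, a = d * b \/ b = d * a.
Proof.
move=> Vval; have [->|a0] := eqVneq a 0; first by exists 0; left; rewrite mul0r.
have [->|b0] := eqVneq b 0; first by exists 0; right; rewrite mul0r.
have aF0 : a%:F != 0 by rewrite tofrac_eq0.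
have bF0 : b%:F != 0 by rewrite tofrac_eq0.
have [|[d _ dE]|[d _ dE]] := Vval (a%:F / b%:F); first by rewrite mulf_neq0 ?invr_neq0.
  by exists d; left; apply/eqP; rewrite -tofrac_eq tofracM dE divfK.
by exists d; right; apply/eqP; rewrite -tofrac_eq tofracM dE invf_div divfK.
Qed.

Lemma valuation_at_localization (R : idomainType) (p : prime_idealr R) :
  valuation_domain (localization p) -> valuation_at p.
Proof.
move=> p_val a b.
have [d dE] := valuation_domain_total (to_loc p a) (to_loc p b) p_val.
have [s sp [e eE]] := localization_repr d.
exists s => //; exists e; case: dE => dE; [left | right];
  by apply: (@to_loc_inj _ p); rewrite !rmorphM /= -eE dE mulrCA mulrA.
Qed.

(** If some [q] in [D] contains all of [m], then localizing R_m at [q] changes nothing, so R_m is a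
    valuation ring. Otherwise every [q] in [D] contracts to a prime strictly below [m], and R_m is
    the intersection of its localizations at these [q]. *)
Lemma essential_localization_cases (R : idomainType) (m : prime_idealr R) :
    essential (localization m) ->
  valuation_at m \/
  forall x : {fraction R},
    (forall p : prime_idealr R, lt_prime p m -> x \in loc_pred p) ->
    x \in loc_pred m.
Proof.
move=> [D [D_val D_cap]].
have [[q [Dq mq]]|nq] := pselect (exists q, D q /\ forall t, t \in m -> to_loc m t \in q).
  left=> a b; have [w wq [d dE]] :=
    valuation_at_localization (D_val q Dq) (to_loc m a) (to_loc m b).
  have [s sm [w1 w1E]] := localization_repr w.
  have [t tm [d1 d1E]] := localization_repr d.
  have w1m : w1 \notin m.
    apply: contra wq => /mq; rewrite -w1E prime_idealrM.
    by rewrite (negPf (to_loc_notin _ sm)) orbF.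
  exists (w1 * t); first by rewrite prime_idealrM negb_or w1m tm.
  have key u v : w * to_loc m u = d * to_loc m v -> w1 * t * u = d1 * s * v.
    move=> uv; apply: (@to_loc_inj _ m); rewrite !rmorphM /= -w1E -d1E.
    rewrite mulrAC [w * _ * _]mulrAC uv -!mulrA; congr (d * _).
    by rewrite [RHS]mulrC mulrCA mulrA.
  by exists (d1 * s); case: dE => dE; [left | right]; apply: key.
right=> x xp; have [[a b] /= b0 xE] := fraction_repr x.
have bL0 : to_loc m b != 0 by rewrite -(inj_eq (@to_loc_inj _ m)) rmorph0 in b0.
(* The intersection given by [D] lives in the fraction field of R_m, so [x], equal to [a / b], is
   rebuilt there first. *)
have : range (@FracField.tofrac (localization m)) ((to_loc m a)%:F / (to_loc m b)%:F).
  rewrite D_cap => q Dq /=.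
  have [|a' [b' [b'q xE']]] := loc_predP _ _ (xp (contraction (to_loc m) q) _).
    split=> [t|].
      by rewrite contractionE; apply: contraTT => tm; apply: to_loc_notin.
    apply: contrapT => nt; apply: nq; exists q; split=> // t tm.
    by apply/negPn/negP => tq; apply: nt; exists t; rewrite ?contractionE.
  rewrite contractionE in b'q; apply/loc_predP; exists (to_loc m a'), (to_loc m b').
  split=> //; apply/eqP; rewrite eqr_div ?tofrac_eq0 ?bL0 ?(contraNneq _ b'q) //.
    rewrite -!tofracM tofrac_eq -!rmorphM; apply/eqP; congr (to_loc m _); apply/eqP.
    rewrite -tofrac_eq !tofracM -eqr_div ?tofrac_eq0 // -?xE -?xE' //.
    by apply: contraNneq b'q => ->; rewrite rmorph0 idealr0.
  by move=> /= ->; rewrite idealr0.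
case=> y _ yE; suff -> : x = val y by exact: valP.
have {}yE : y * to_loc m b = to_loc m a.
  by apply/eqP; rewrite -tofrac_eq tofracM yE divfK ?tofrac_eq0.
rewrite xE; apply: (canLR (mulfK _)); first by rewrite tofrac_eq0.
by rewrite -[RHS](rmorphM val y (to_loc m b)) yE.
Qed.

(** An element [t] of [m] outside [p] supplies infinitely many nodes for interpolation over R_p, and
    the values of [f] there lie in R. *)
Lemma int_poly_over_localization (R : idomainType) (p m : prime_idealr R)
    (f : {poly {fraction R}}) :
  lt_prime p m -> f \in @int_pred R -> f \is a polyOver (loc_pred p).
Proof.
move=> [pm [t tm tp]] /int_predP fR.
have tofracV a : a \notin p -> (a%:F)^-1 \in loc_pred p.
  by move=> ap; apply/loc_predP; exists 1, a; rewrite tofrac1 mul1r.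
have tXp n : t ^+ n \notin p.
  by elim: n => [|n IHn]; rewrite ?expr0 ?idealr1 // exprS prime_idealrM negb_or tp.
(* The powers of t are distinct modulo p, since t ^+ k - 1 is never in m. *)
apply: (polyOver_interpolation (a := fun i => (t ^+ i)%:F)) => [i|i|i k ik].
- exact: tofrac_in_loc.
- by have [b _ <-] := fR (t ^+ i); apply: tofrac_in_loc.
have : t ^+ i - t ^+ k \notin p.
  rewrite -(subnKC (ltnW ik)) exprD -{1}[t ^+ i]mulr1 -mulrBr prime_idealrM.
  rewrite negb_or tXp /=; apply/negP => /pm tm1.
  have := idealr1 m; rewrite -[1](subrK (t ^+ (k - i))) rpredD //.
  by rewrite -(prednK (n := k - i)) ?subn_gt0 // exprS mulrC idealMr.
move=> tp'; split; last by rewrite -tofracB tofracV.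
by rewrite tofrac_eq -subr_eq0; apply: contraNneq tp' => ->; rewrite idealr0.
Qed.

(** * Rings between R[X] and Int(R) *)

Section IntermediateRing.
Variables (R : idomainType) (A : comNzRingType).
Variables (phi : {rmorphism A -> {poly {fraction R}}}) (j : {rmorphism {poly R} -> A}).
Hypothesis phi_inj : injective phi.
Hypothesis phi_j : forall f, phi (j f) = map_poly (@FracField.tofrac R) f.
Hypothesis phi_int : forall f, phi f \in @int_pred R.

Definition const_in : {rmorphism R -> A} := j \o polyC.

Lemma phi_const a : phi (const_in a) = (a%:F)%:P.
Proof. by rewrite /= phi_j map_polyC. Qed.

Lemma j_inj : injective j.
Proof.
move=> f g /(congr1 phi); rewrite !phi_j => fg; apply/polyP => i.
by apply/eqP; rewrite -tofrac_eq -!coef_map /= fg.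
Qed.

Lemma const_reg e z : e != 0 -> const_in e * z = 0 -> z = 0.
Proof.
move=> e0 /(congr1 phi); rewrite rmorphM rmorph0 phi_const => /eqP.
rewrite mulf_eq0 polyC_eq0 tofrac_eq0 (negPf e0) /= => /eqP z0.
by apply: phi_inj; rewrite z0 rmorph0.
Qed.

Lemma monomials_dependent_over_const (x y : A) : exists N (c : nat -> nat -> R),
  (exists i k, [/\ (i < N)%N, (k < N)%N & c i k != 0]) /\
  \sum_(i < N) \sum_(k < N) const_in (c i k) * x ^+ i * y ^+ k = 0.
Proof.
have [N [c [[i [k [iN kN cik]]] cxy]]] := monomials_dependent (phi x) (phi y).
(* The localization at the zero prime is the whole quotient field, so [common_denominator] can clear
   the coefficients of a relation over K. *)
have [z zE] := zero_prime R.
pose l := [seq (u, v) | u <- seq.iota 0 N, v <- seq.iota 0 N].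
have [|s [a [sz aP]]] := @common_denominator _ z _ l (fun uv => c uv.1 uv.2).
  move=> uv _; have [[n d] /= d0 ->] := fraction_repr (c uv.1 uv.2).
  by apply/loc_predP; exists n, d; rewrite zE.
have {}aP u v : (u < N)%N -> (v < N)%N -> s%:F * c u v = (a (u, v))%:F.
  move=> uN vN; rewrite -aP //; apply/allpairsP; exists (u, v).
  by rewrite !mem_iota.
have s0 : s%:F != 0 by rewrite tofrac_eq0 -zE.
exists N, (fun u v => a (u, v)); split.
  by exists i, k; split=> //; rewrite -tofrac_eq0 -aP // mulf_neq0.
apply: phi_inj; rewrite rmorph0 -[RHS](mulr0 (s%:F)%:P) -cxy rmorph_sum big_distrr.
apply: eq_bigr => u _; rewrite rmorph_sum big_distrr; apply: eq_bigr => v _.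
by rewrite !rmorphM !rmorphXn phi_const -aP ?ltn_ord // polyCM -!mulrA.
Qed.

(** Evaluation at 0 is a retraction of [A] onto R, so primes of R pull back with their strict
    inclusions. The zero ideal fits strictly below them because [X] is nonzero and vanishes at 0. *)
Lemma chain_over_constants n : prime_chain R n -> prime_chain A n.+1.
Proof.
case/prime_chainP => c c_lt.
have /choice[e eE] : forall f, exists a, (phi f).[0] = a%:F.
  by move=> f; have /int_predP/(_ 0)[a _ <-] := phi_int f; exists a; rewrite ?tofrac0.
have eB f g : e (f - g) = e f - e g.
  by apply/eqP; rewrite -tofrac_eq tofracB -!eE rmorphB hornerD hornerN.
have eM f g : e (f * g) = e f * e g.
  by apply/eqP; rewrite -tofrac_eq tofracM -!eE rmorphM hornerM.
have eC a : e (const_in a) = a.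
  by apply/eqP; rewrite -tofrac_eq -eE phi_const hornerC.
have /choice[Q QE] : forall i, exists Q : prime_idealr A,
    forall f, (f \in Q) = `[< e f \in c i >].
  move=> i; apply: exists_prime_idealr => [||f g fi gi|f g gi|f g].
  - by rewrite -[0](subrr 0) eB subrr idealr0.
  - by rewrite -(rmorph1 const_in) eC idealr1.
  - by rewrite eB rpredB.
  - by rewrite eM idealMr.
  - by rewrite eM prime_idealrM => /orP.
have {}QE i f : (f \in Q i) = (e f \in c i) by rewrite QE asboolb.
have [z zE] := zero_prime {poly {fraction R}}.
(* [A] is not given as a domain, so its zero ideal is the contraction of that of K[X] along the
   injective [phi]. *)
apply: (@chain_of_steps _ _ (fun i => if i is i'.+1 then Q i' else contraction phi z)).
case=> [_|i i_n].
  split=> [f|]; first rewrite contractionE zE QE => /eqP f0.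
    suff -> : e f = 0 by apply: idealr0.
    by apply/eqP; rewrite -tofrac_eq0 -eE f0 horner0.
  have eX : e (j 'X) = 0 by apply/eqP; rewrite -tofrac_eq0 -eE phi_j map_polyX hornerX.
  exists (j 'X); first by rewrite QE eX idealr0.
  by rewrite contractionE zE phi_j map_polyX polyX_eq0.
have [|sub [a ai ani]] := c_lt i i.+1; first by rewrite ltnSn.
by split=> [f|]; [rewrite !QE; apply: sub | exists (const_in a); rewrite QE eC].
Qed.

Section FractionsOverLocalization.
Variable m : prime_idealr R.
Hypothesis phi_over : forall f, phi f \is a polyOver (loc_pred m).

(** The finitely many coefficients have a common denominator outside [m]; thus inverting R \ m makes
    [A] and R[X] equal. *)
Lemma scale_into_poly f : exists2 s, s \notin m & exists g, const_in s * f = j g.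
Proof.
have /polyOverP cm := phi_over f.
have [//|s [a [sm aP]]] := @common_denominator _ m _ (seq.iota 0 (size (phi f)))
  (fun i => (phi f)`_i).
exists s => //; exists (\poly_(i < size (phi f)) a i); apply: phi_inj.
rewrite phi_j rmorphM phi_const; apply/polyP => i.
rewrite coefCM coef_map coef_poly /=; case: ltnP => [i_lt|ge_i].
  by rewrite aP // mem_iota.
by rewrite nth_default // mulr0 tofrac0.
Qed.

(** Multiplying a witness of strictness by a suitable [s] outside [m] moves it into R[X]. It remains
    a witness, since [s] lies outside every prime of the chain. *)
Lemma chain_contracts n (c : nat -> prime_idealr A) :
    (forall i k, (i < k <= n)%N -> lt_prime (c i) (c k)) ->
    (forall a, const_in a \in c n -> a \in m) ->
  prime_chain {poly R} n.
Proof.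
move=> c_lt cm; apply: (@chain_of_steps _ _ (fun i => contraction j (c i))) => i i_n.
have [|sub [f fi fni]] := c_lt i i.+1; first by rewrite ltnSn.
split=> [g|]; first by rewrite !contractionE; apply: sub.
have [s sm [g gE]] := scale_into_poly f.
exists g; rewrite contractionE -gE; first by rewrite idealMr.
rewrite prime_idealrM negb_or fni andbT; apply: contra sm => si; apply: cm.
by have [|sub' _] := c_lt i n; [rewrite i_n leqnn | apply: sub'].
Qed.

(** [Q] consists of the elements of [A] that lie in the extension of [P] to the localization of R[X]
    at R \ m. It is proper since no constant of [P] is outside [m]. *)
Lemma extended_prime (P : prime_idealr {poly R}) :
    (forall a, a%:P \in P -> a \in m) ->
  exists Q : prime_idealr A, forall f,
    (f \in Q) = `[< exists2 s, s \notin m & exists2 g, g \in P & const_in s * f = j g >].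
Proof.
move=> Pm; have notP s : s \notin m -> s%:P \notin P by apply: contra => /Pm.
have jC s g : const_in s * j g = j (s%:P * g) by rewrite rmorphM.
have notm s t : s \notin m -> t \notin m -> s * t \notin m.
  by move=> sm tm; rewrite prime_idealrM negb_or sm.
apply: exists_prime_idealr.
- by exists 1; [rewrite idealr1 | exists 0; rewrite ?idealr0 // mulr0 rmorph0].
- move=> [s sm [g gP]]; rewrite mulr1 => /j_inj sg; have := notP s sm.
  by rewrite sg gP.
- move=> f g [s sm [f' f'P fE]] [t tm [g' g'P gE]].
  exists (s * t); first exact: notm.
  exists (t%:P * f' - s%:P * g'); first by rewrite rpredB ?idealMr.
  by rewrite rmorphB -!jC -fE -gE mulrBr !rmorphM !mulrA [const_in t * _]mulrC.
- move=> f g [s sm [g' g'P gE]]; have [t tm [f' fE]] := scale_into_poly f.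
  exists (t * s); first exact: notm.
  exists (f' * g'); first by rewrite idealMr.
  by rewrite (rmorphM const_in) mulrACA fE gE -rmorphM.
move=> f g [s sm [h hP hE]]; have [t tm [f' fE]] := scale_into_poly f.
have [u um [g' gE]] := scale_into_poly g.
have : s%:P * (f' * g') \in P.
  suff -> : s%:P * (f' * g') = (t%:P * u%:P) * h by rewrite idealMr.
  apply: j_inj; rewrite -jC (rmorphM j f') -fE -gE -polyCM -jC -hE (rmorphM const_in t).
  by rewrite mulrACA [LHS]mulrCA.
rewrite !prime_idealrM (negPf (notP _ sm)) /= => /orP[f'P|g'P].
  by left; exists t => //; exists f'.
by right; exists u => //; exists g'.
Qed.

Lemma chain_extends n (c : nat -> prime_idealr {poly R}) :
    (forall i k, (i < k <= n)%N -> lt_prime (c i) (c k)) ->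
    (forall a, a%:P \in c n -> a \in m) ->
  prime_chain A n.
Proof.
move=> c_lt cm.
have below i : (i <= n)%N -> forall a, a%:P \in c i -> a \in m.
  rewrite leq_eqVlt => /predU1P[-> //|i_n] a ai; apply: cm.
  by have [|sub _] := c_lt i n; [rewrite i_n leqnn | apply: sub].
(* [minn n i] bounds every index by [n], so that a prime can be chosen for all [i]; indices up to
   [n] are unaffected. *)
have /choice[Q QE] := fun i => extended_prime (below _ (geq_minl n i)).
apply: (@chain_of_steps _ _ Q) => i i_n.
have [|sub [g gi gni]] := c_lt i i.+1; first by rewrite ltnSn.
have mE k : (k <= n)%N -> minn n k = k by move/minn_idPr.
split=> [f|].
  rewrite !QE !mE // 1?ltnW // => /asboolP[s sm [h hi hE]]; apply/asboolP.
  by exists s => //; exists h => //; apply: sub.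
exists (j g); rewrite QE mE // 1?ltnW //.
  apply/asboolP; exists 1; first by rewrite idealr1.
  by exists g; rewrite // rmorph1 mul1r.
apply/asboolP => -[s sm [h hi]]; rewrite -[const_in s]/(j s%:P) -rmorphM => /j_inj sg.
move: hi; rewrite -sg prime_idealrM (negPf gni) orbF => /(below _ (ltnW i_n)).
exact/negP.
Qed.

End FractionsOverLocalization.

Lemma over_localization (m : prime_idealr R) :
    locally_essential R -> ~ valuation_at m ->
  forall f, phi f \is a polyOver (loc_pred m).
Proof.
move=> R_ess m_nval f; have [//|capm] := essential_localization_cases (R_ess m).
apply/polyOverP => i; apply: capm => p p_lt.
by have /polyOverP := int_poly_over_localization p_lt (phi_int f).
Qed.

Lemma contracted_chain_of_valuation (m : prime_idealr R) n (c : nat -> prime_idealr A) :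
    valuation_at m ->
    (forall i k, (i < k <= n.+1)%N -> lt_prime (c i) (c k)) ->
    (forall a, const_in a \in c n.+1 -> a \in m) ->
  prime_chain R n.
Proof.
move=> m_val; apply: (contracted_chain m_val const_reg).
exact: monomials_dependent_over_const.
Qed.

End IntermediateRing.

(** * Comparison of Int(R) with R[X] *)

Section IntPoly.
Variable R : idomainType.

Lemma map_tofrac_int (f : {poly R}) : map_poly (@FracField.tofrac R) f \in @int_pred R.
Proof. by apply/int_predP => a; exists f.[a]; rewrite // horner_map. Qed.

Definition to_int_poly (f : {poly R}) : int_poly R := IntPoly (map_tofrac_int f).

Lemma to_int_poly_zmod_morphism : zmod_morphism to_int_poly.
Proof. by move=> f g; apply: val_inj; rewrite rmorphB /= rmorphB. Qed.

Lemma to_int_poly_monoid_morphism : monoid_morphism to_int_poly.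
Proof.
by split=> [|f g]; apply: val_inj; rewrite ?rmorph1 ?rmorphM /= ?rmorph1 ?rmorphM.
Qed.

HB.instance Definition _ :=
  GRing.isZmodMorphism.Build {poly R} (int_poly R) to_int_poly
    to_int_poly_zmod_morphism.
HB.instance Definition _ :=
  GRing.isMonoidMorphism.Build {poly R} (int_poly R) to_int_poly
    to_int_poly_monoid_morphism.

Lemma int_poly_valP (f : int_poly R) : val f \in @int_pred R.
Proof. exact: valP. Qed.

Lemma map_tofrac_inj : injective (map_poly (@FracField.tofrac R)).
Proof. by apply: map_inj_poly => [a b /eqP|]; rewrite ?tofrac0 ?tofrac_eq // => /eqP. Qed.

Lemma prime_chain_int_poly n :
  locally_essential R -> prime_chain (int_poly R) n <-> prime_chain {poly R} n.
Proof.
move=> R_ess.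
have to_intE (f : {poly R}) :
  val (to_int_poly f) = map_poly (@FracField.tofrac R) f by [].
(* With [j] the identity, R[X] itself is an intermediate ring, so the same lemmas apply to it. *)
have idE (f : {poly R}) : map_poly (@FracField.tofrac R) (idfun f) =
  map_poly (@FracField.tofrac R) f by [].
split=> /prime_chainP[c c_lt].
  (* Length 0 is treated apart: it only needs some prime to exist, while the valuation case loses
     one step and then regains it. *)
  case: n c_lt => [|n] c_lt.
    have [z _] := zero_prime {poly R}.
    exact: (@chain_of_steps _ 0 (fun=> z)).
  pose m := contraction (const_in to_int_poly) (c n.+1).
  have cm a : const_in to_int_poly a \in c n.+1 -> a \in m by rewrite contractionE.
  have [m_val|m_nval] := pselect (valuation_at m).
    apply: (chain_over_constants idE map_tofrac_int).
    exact: (contracted_chain_of_valuation val_inj to_intE m_val c_lt cm).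
  have over := over_localization int_poly_valP R_ess m_nval.
  exact: (chain_contracts val_inj to_intE over c_lt cm).
case: n c_lt => [|n] c_lt.
  have [z _] := zero_prime {poly {fraction R}}.
  exact: (@chain_of_steps _ 0 (fun=> contraction val z)).
pose m := contraction (const_in idfun) (c n.+1).
have cm a : const_in idfun a \in c n.+1 -> a \in m by rewrite contractionE.
have [m_val|m_nval] := pselect (valuation_at m).
  apply: (chain_over_constants to_intE int_poly_valP).
  exact: (contracted_chain_of_valuation map_tofrac_inj idE m_val c_lt cm).
have over := over_localization int_poly_valP R_ess m_nval.
exact: (chain_extends val_inj to_intE over c_lt cm).
Qed.

End IntPoly.

Theorem theorem2p1 (R : idomainType) (hR : locally_essential R) :
  krull_dim (int_poly R) = krull_dim {poly R}.
Proof.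
(* The dimension depends only on which chain lengths occur, so finite and infinite dimension are
   handled at once. *)
have chainE n := propext (prime_chain_int_poly n hR).
by rewrite /krull_dim (funext chainE).
Qed.
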